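(* Let $\eta \in (0,1)$ be an arbitrary constant and let $d \ge 2$. For a stream of triples $(q_i,k_i,v_i)\in(\mathbb{R}^d)^3$, $i=1,\dots,n$, let $Z_i := \operatorname{Attn}(q_i,K_i,V_i)\in\mathbb{R}^d$. Any streaming algorithm that can, with probability at least $9/10$, for all timesteps $i\le n$, produce a $(1\pm\eta)$-approximation $\mathcal{O}_i$ of $Z_i$ must use at least $\Omega(d\cdot\min\{n,e^d\})$ bits of memory.
   Context: Setting (attention-based token generation / KV cache compression): the input is a stream of $n$ triples $(q_i,k_i,v_i)\in(\mathbb{R}^d)^3$ arriving one at a time; $d$ is the embedding dimension. A (possibly randomized) one-pass streaming algorithm processes the triples in order, keeping a memory state whose size in bits is its space usage; its guarantee must hold for every input stream, the probability being over its own randomness. For each $i$, $K_i$ and $V_i$ are the $i\times d$ matrices whose rows are $k_1^T,\dots,k_i^T$ and $v_1^T,\dots,v_i^T$ respectively. The attention function is $\operatorname{Attn}(q_i,K_i,V_i) := \sigma_i(K_i q_i)^T V_i = \sum_{\ell=1}^i \frac{e^{q_i^Tk_\ell}}{\sum_{m=1}^i e^{q_i^Tk_m}}\, v_\ell\in\mathbb{R}^d$, where $\sigma_i:\mathbb{R}^i\to\mathbb{R}^i$ is the softmax function. A vector $x\in\mathbb{R}^d$ is a $(1\pm\eta)$-approximation of $y\in\mathbb{R}^d$ if $|x_j-y_j|\le\eta\cdot y_j$ for all $j\in[d]$. *)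

(* Defs.v *)
From HB Require Import structures.
From mathcomp Require Import all_boot all_order all_algebra.
From mathcomp Require Import all_classical all_reals all_analysis.

Set Implicit Arguments.
Unset Strict Implicit.
Unset Printing Implicit Defensive.

Import Order.TTheory GRing.Theory Num.Theory.

Local Open Scope classical_set_scope.
Local Open Scope ring_scope.

(* Vectors of R^d are row vectors, so that row l of K_i is k_l and the
   softmax is applied to the column K_i q_i^T. *)
Record triple (R : realType) (d : nat) := Triple {
  qry : 'rV[R]_d;
  key : 'rV[R]_d;
  val : 'rV[R]_d }.

(* A stream of length n is given by its entries of index 0, ..., n-1; the
   remaining entries are never read.  Index i stands for time step i+1. *)
Definition stream (R : realType) (d : nat) := nat -> triple R d.

Definition keys (R : realType) d (x : stream R d) (i : nat) : 'M[R]_(i.+1, d) :=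
  \matrix_(l < i.+1) key (x l).

Definition vals (R : realType) d (x : stream R d) (i : nat) : 'M[R]_(i.+1, d) :=
  \matrix_(l < i.+1) val (x l).

Definition softmax (R : realType) m (u : 'cV[R]_m) : 'cV[R]_m :=
  \col_l (expR (u l ord0) / \sum_(p < m) expR (u p ord0)).

Definition Attn (R : realType) m d
    (q : 'rV[R]_d) (K V : 'M[R]_(m, d)) : 'rV[R]_d :=
  (softmax (K *m q^T))^T *m V.

Definition attn_at (R : realType) d (x : stream R d) (i : nat) : 'rV[R]_d :=
  Attn (qry (x i)) (keys x i) (vals x i).

Definition approx (R : realType) d (eta : R) (x y : 'rV[R]_d) : Prop :=
  forall j : 'I_d, `|x ord0 j - y ord0 j| <= eta * y ord0 j.

(* A randomized one-pass streaming algorithm whose memory is s bits.  The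
   sample w is its random string: it can be reread at every step and is not
   charged to the memory.  The algorithm may depend on the time step, and it
   produces the output of step i from its memory and the i-th triple, before
   that triple is gone; a lower bound in this model thus also covers
   algorithms that charge for the clock or the random bits, or that output
   from the updated memory only. *)
Record streaming_alg (disp : measure_display) (T : measurableType disp)
    (R : realType) (d s : nat) := StreamingAlg {
  init : T -> s.-tuple bool;
  step : T -> nat -> s.-tuple bool -> triple R d -> s.-tuple bool;
  output : T -> nat -> s.-tuple bool -> triple R d -> 'rV[R]_d;
  measurable_init : forall m, measurable [set w | init w = m];
  measurable_step :
    forall i m t m', measurable [set w | step w i m t = m'];
  measurable_output :
    forall i m t j, measurable_fun [set: T] (fun w => output w i m t ord0 j) }.

Fixpoint memory disp (T : measurableType disp) (R : realType) d s
    (A : streaming_alg T R d s) (w : T) (x : stream R d) (i : nat)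
    : s.-tuple bool :=
  if i is i'.+1 then step A w i' (memory A w x i') (x i') else init A w.

Definition answer disp (T : measurableType disp) (R : realType) d s
    (A : streaming_alg T R d s) (w : T) (x : stream R d) (i : nat) : 'rV[R]_d :=
  output A w i (memory A w x i) (x i).

(* The guarantee is required of every stream of length n over the input
   domain D, and the approximation has to hold at all time steps
   simultaneously with probability at least 9/10. *)
Definition approximates_attention disp (T : measurableType disp)
    (R : realType) (P : probability T R) d s (A : streaming_alg T R d s)
    (D : set (triple R d)) (n : nat) (eta : R) : Prop :=
  forall x : stream R d, (forall i, (i < n)%N -> D (x i)) ->
    ((9 / 10)%:E <=
     P [set w | forall i, (i < n)%N ->
                  approx eta (answer A w x i) (attn_at x i)])%E.

(* Triples with integer coordinates of absolute value at most B and
   nonnegative values.  On all of (R^d)^3 the guarantee cannot be met by a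
   finite memory once n >= 2, nor by anyone when some y_j < 0; a lower bound
   for every domain D containing bounded_int_triples R d (n ^ a) covers
   D = setT and also the domains on which algorithms do exist. *)
Definition bounded_int_triples (R : realType) (d B : nat) : set (triple R d) :=
  [set t | forall j : 'I_d,
    [/\ qry t ord0 j \is a Num.int /\ `|qry t ord0 j| <= B%:R,
        key t ord0 j \is a Num.int /\ `|key t ord0 j| <= B%:R &
        val t ord0 j \is a Num.nat /\ val t ord0 j <= B%:R]].
Arguments bounded_int_triples : clear implicits.

(* Main.v *)
(* Even in dimension 2, all scores can be separated: with keys (p, -p^2) the
   query n^2 (2 l, 1) has score n^2 (l^2 - (l - p)^2), so l beats every other
   key by at least n^2 and the attention is v_l up to n exp(-n^2) <= 1/n.  A
   stream that stores N = n/2 rows of d bits as values and then queries them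
   one after the other thus lets the rows be read off the approximate answers.
   For a fixed random string the rows decoded correctly are a function of the
   memory at time N, so at most 2^s of the 2^(Nd) bit matrices succeed;
   averaging over the random string gives 9/10 * 2^(Nd) <= 2^s. *)

Require Import Defs.
From HB Require Import structures.
From mathcomp Require Import all_boot all_order all_algebra.
From mathcomp Require Import all_classical all_reals all_analysis.
From mathcomp Require Import measurable_realfun.
From mathcomp Require Import ring lra zify.

Set Implicit Arguments.
Unset Strict Implicit.
Unset Printing Implicit Defensive.

Import Order.TTheory GRing.Theory Num.Theory.

Local Open Scope classical_set_scope.
Local Open Scope ring_scope.

(** * Softmax concentration under a score gap *)

Lemma AttnE (R : realType) m d (q : 'rV[R]_d) (K V : 'M[R]_(m, d)) j :
  Attn q K V ord0 j =
  \sum_(p < m) softmax (K *m q^T) p ord0 * V p j.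
Proof. by rewrite /Attn mxE; apply: eq_bigr => p _; rewrite mxE. Qed.

Lemma softmax_ge0 (R : realType) m (u : 'cV[R]_m) p : 0 <= softmax u p ord0.
Proof. by rewrite mxE divr_ge0 ?expR_ge0// sumr_ge0// => i _; exact: expR_ge0. Qed.

Lemma expR_le_sum (R : realType) m (u : 'cV[R]_m) (l : 'I_m) :
  expR (u l ord0) <= \sum_(p < m) expR (u p ord0).
Proof. by rewrite (bigD1 l)//= lerDl sumr_ge0// => i _; exact: expR_ge0. Qed.

Lemma sum_softmax (R : realType) m (u : 'cV[R]_m.+1) :
  \sum_p softmax u p ord0 = 1.
Proof.
under eq_bigr do rewrite mxE.
rewrite -mulr_suml divff// gt_eqF//.
exact: lt_le_trans (expR_gt0 _) (expR_le_sum u ord0).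
Qed.

Lemma softmax_le (R : realType) m (u : 'cV[R]_m) (p l : 'I_m) (M : R) :
  u p ord0 + M <= u l ord0 -> softmax u p ord0 <= expR (- M).
Proof.
move=> upl; rewrite mxE ler_pdivrMr; last first.
  exact: lt_le_trans (expR_gt0 _) (expR_le_sum u l).
apply: le_trans (ler_wpM2l (expR_ge0 _) (expR_le_sum u l)).
by rewrite -expRD ler_expR; lra.
Qed.

(** The weights sum to 1, so the error is the weighted sum of [V p j - V l j]: the term [l]
    vanishes, and any other has weight at most [expR (- M)] and a difference in [-1, 1]. *)
Lemma Attn_near (R : realType) m d (q : 'rV[R]_d) (K V : 'M[R]_(m.+1, d)) l
    (M : R) :
  (forall p, p != l ->
    (K *m q^T) p ord0 + M <= (K *m q^T) l ord0) ->
  (forall p j, 0 <= V p j <= 1) ->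
  forall j, `|Attn q K V ord0 j - V l j| <= m.+1%:R * expR (- M).
Proof.
move=> gap V01 j; set u := K *m q^T in gap *.
have -> : Attn q K V ord0 j - V l j =
    \sum_p softmax u p ord0 * (V p j - V l j).
  under eq_bigr do rewrite mulrBr.
  by rewrite sumrB -mulr_suml sum_softmax mul1r AttnE.
apply: le_trans (ler_norm_sum _ _ _) _.
rewrite mulr_natl -[X in _ *+ X]card_ord -sumr_const.
apply: ler_sum => p _; have [->|pl] := eqVneq p l.
  by rewrite subrr mulr0 normr0 expR_ge0.
rewrite normrM ger0_norm ?softmax_ge0//.
apply: le_trans (softmax_le (gap p pl)).
rewrite ler_piMr ?softmax_ge0// ler_norml.
by have := V01 p j; have := V01 l j; lra.
Qed.

(** If the bits were 1 and 0, then [o] would be at least (1 - eta) z1 >= 3/4 (1 - eta) and at most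
    (1 + eta) z2 <= 2 z2 <= (1 - eta) / 2. *)
Lemma approx_bit_inj (R : realType) (eta del z1 z2 o : R) (b1 b2 : bool) :
  0 < eta < 1 -> del <= (1 - eta) / 4 ->
  `|z1 - b1%:R| <= del -> `|z2 - b2%:R| <= del ->
  `|o - z1| <= eta * z1 -> `|o - z2| <= eta * z2 -> b1 = b2.
Proof.
move=> e01 dle.
wlog : b1 b2 z1 z2 / b1 && ~~ b2.
  move=> H; case: b1; case: b2 => // z1b z2b o1 o2.
    exact: (H true false z1 z2).
  by symmetry; exact: (H true false z2 z1).
case/andP; case: b1 => // _; case: b2 => // _.
rewrite !ler_norml/= => /andP[? ?] /andP[? ?] /andP[? ?] /andP[? ?].
have e0 : 0 < eta by lra.
(* [eta * z2] bounds an absolute value, hence is nonnegative. *)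
have z20 : 0 <= z2 by rewrite -(pmulr_rge0 _ e0); lra.
have : 0 <= (1 - eta) * z2 by rewrite mulr_ge0//; lra.
have : 0 <= (1 - eta) * (z1 - 3 / 4) by rewrite mulr_ge0//; lra.
rewrite !mulrBl !mulrBr; lra.
Qed.

(** * Averaging over the random string, and measurability of success *)

(** Double counting: the sum of the [P (E x)] is the expected number of [x] whose event occurs, and
    that number is at most [k] pointwise. *)
Lemma expected_count disp (T : measurableType disp) (R : realType)
    (P : probability T R) (I : finType) (E : I -> set T) (p : R) (k : nat) :
  (forall x, measurable (E x)) -> (forall x, (p%:E <= P (E x))%E) ->
  (forall w, (#|[set x | `[< E x w >]]%SET| <= k)%N) ->
  p * #|I|%:R <= k%:R.
Proof.
move=> mE pE Ek; rewrite -lee_fin.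
have ->: (p * #|I|%:R)%:E = (\sum_(x : I) p%:E)%E.
  by rewrite sumEFin sumr_const mulr_natr.
apply: (@le_trans _ _ (\sum_(x : I) P (E x))%E); first exact: lee_sum.
have -> : (\sum_(x : I) P (E x) = \int[P]_w \sum_(x : I) (\1_(E x) w)%:E)%E.
  rewrite ge0_integral_sum//; last first.
    by move=> x; apply/measurable_EFinP; exact: measurable_indic.
  by apply: eq_bigr => x _; rewrite integral_indic// setIT.
have -> : k%:R%:E = (\int[P]_w cst k%:R%:E w)%E.
  by rewrite integral_cst// -[X in X = _]mule1 -(probability_setT P).
apply: ge0_le_integral => //.
- by move=> w _; rewrite sume_ge0.
- apply: emeasurable_sum => x.
  by apply/measurable_EFinP; exact: measurable_indic.
move=> w _; rewrite sumEFin lee_fin /=.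
under eq_bigr do rewrite indicE.
rewrite -natr_sum ler_nat; apply: leq_trans (Ek w).
rewrite -sum1dep_card [leqRHS]big_mkcond/=; apply: leq_sum => x _.
by case: asboolP => [_|nEw]; [exact: leq_b1 | rewrite memNset].
Qed.

Lemma measurable_memory disp (T : measurableType disp) (R : realType) d s
    (A : streaming_alg T R d s) (x : stream R d) i m :
  measurable [set w | memory A w x i = m].
Proof.
elim: i m => [|i IHi] m /=; first exact: measurable_init.
(* The state fed to [step] is itself random; splitting over its finitely many values leaves only
   transitions from a fixed state. *)
rewrite [X in measurable X](_ : _ = \bigcup_m0
  ([set w | memory A w x i = m0] `&` [set w | step A w i m0 (x i) = m])).
  apply: countable_bigcupT_measurable => [|m0]; first exact: countableP.
  by apply: measurableI => //; exact: measurable_step.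
apply/seteqP; split => [w /= <-|w [m0 _ [/= -> //]]].
by exists (memory A w x i).
Qed.

Lemma measurable_answer disp (T : measurableType disp) (R : realType) d s
    (A : streaming_alg T R d s) (x : stream R d) i j :
  measurable_fun [set: T] (fun w => answer A w x i ord0 j).
Proof.
move=> _ B mB; rewrite setTI.
rewrite [X in measurable X](_ : _ = \bigcup_m ([set w | memory A w x i = m] `&`
  (fun w => output A w i m (x i) ord0 j) @^-1` B)).
  apply: countable_bigcupT_measurable => [|m]; first exact: countableP.
  apply: measurableI; first exact: measurable_memory.
  rewrite -[X in measurable X]setTI.
  exact: (measurable_output A i m (x i) j measurableT mB).
apply/seteqP; split => [w /= Bw|w [m _ [/= <- //]]].
by exists (memory A w x i).
Qed.

Lemma measurable_approx disp (T : measurableType disp) (R : realType) d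
    (eta : R) (f : T -> 'rV[R]_d) (y : 'rV[R]_d) :
  (forall j, measurable_fun [set: T] (fun w => f w ord0 j)) ->
  measurable [set w | Defs.approx eta (f w) y].
Proof.
move=> mf.
rewrite [X in measurable X](_ : _ = \bigcap_(j in [set: 'I_d])
  ((fun w => f w ord0 j) @^-1`
     `[y ord0 j - eta * y ord0 j, y ord0 j + eta * y ord0 j])).
  apply: fin_bigcap_measurable => [|j _]; first exact: finite_finset.
  by rewrite -[X in measurable X]setTI; exact: mf.
apply/seteqP; split => w /= H j.
  by move=> _; have := H j; rewrite /= in_itv/= -ler_distl.
by have := H j Logic.I; rewrite /= in_itv/= -ler_distl.
Qed.

Lemma measurable_success disp (T : measurableType disp) (R : realType) d s
    (A : streaming_alg T R d s) (x : stream R d) n (eta : R) :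
  measurable [set w | forall i, (i < n)%N ->
    Defs.approx eta (answer A w x i) (attn_at x i)].
Proof.
apply: (@fin_bigcap_measurable _ _ _ `I_n) => // i _.
by apply: measurable_approx => j; exact: measurable_answer.
Qed.

(** * Hard streams and decoding from the memory *)

Lemma answer_determined disp (T : measurableType disp) (R : realType) d s
    (A : streaming_alg T R d s) w (x y : stream R d) i0 :
  memory A w x i0 = memory A w y i0 ->
  (forall i, (i0 <= i)%N -> x i = y i) ->
  forall i, (i0 <= i)%N -> answer A w x i = answer A w y i.
Proof.
move=> mem0 xy i ii0; rewrite /answer xy//; congr (output A w i _ _).
rewrite -(subnKC ii0); elim: (i - i0)%N => [|k IHk]; first by rewrite addn0.
by rewrite addnS /= IHk xy// leq_addr.
Qed.

(* In the first N steps the truncated subtraction makes the first coordinate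
   of the query 0; those answers are never used. *)
Definition hard_stream (R : realType) d n N (X : 'M[bool]_(N, d)) : stream R d :=
  fun i => Triple
    (\row_j if j == 0%N :> nat then (2 * (i - N) * n ^ 2)%N%:R
            else if j == 1%N :> nat then (n ^ 2)%N%:R else 0)
    (\row_j if j == 0%N :> nat then i%:R
            else if j == 1%N :> nat then - (i ^ 2)%N%:R else 0)
    (\row_j [exists l : 'I_N, (l == i :> nat) && X l j]%:R).

(** The exponent 3 is dictated by the query: with N = n/2 the factor [2 * (i - N)] is at most n, and
    it multiplies n^2. *)
Lemma hard_stream_bounded (R : realType) d n (X : 'M[bool]_(n./2, d)) i :
  (i < n)%N -> bounded_int_triples R d (n ^ 3) (hard_stream R n X i).
Proof.
move=> ltin j; have n0 : (0 < n)%N by lia.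
have n3 : (n ^ 2 <= n ^ 3)%N by rewrite leq_pexp2l.
have nn3 : (n <= n ^ 3)%N by rewrite -{1}(expn1 n) leq_pexp2l.
rewrite /= !mxE; split.
- case: ifP => _; last case: ifP => _.
  + rewrite normr_nat ler_nat; split => //.
    by rewrite (expnS n 2) leq_mul2r; apply/orP; right; lia.
  + by rewrite normr_nat ler_nat.
  + by rewrite normr0 ler0n.
- case: ifP => _; last case: ifP => _.
  + by rewrite normr_nat ler_nat; split => //; lia.
  + rewrite normrN normr_nat ler_nat rpredN rpred_nat; split => //.
    by apply: leq_trans n3; rewrite leq_exp2r// ltnW.
  + by rewrite normr0 ler0n.
- split => //; rewrite ler_nat; apply: leq_trans (leq_b1 _) _.
  by rewrite expn_gt0 n0.
Qed.

Lemma hard_score (R : realType) d n N (X : 'M[bool]_(N, d)) i p :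
  (2 <= d)%N -> let x := hard_stream R n X in
  (keys x i *m (qry (x i))^T) p ord0 =
  n%:R ^+ 2 * ((i - N)%:R ^+ 2 - ((i - N)%:R - p%:R) ^+ 2).
Proof.
move=> d2 x; case: d d2 X @x => [//|[//|d]] _ X x.
rewrite mxE 2!big_ord_recl big1 => [|j _]; rewrite !mxE/=; last by rewrite mul0r.
by rewrite !natrM; ring.
Qed.

(** Keys written from time [N] on compete in the softmax too, but the gap n^2 holds against every
    index other than [l]. *)
Lemma hard_attn (R : realType) d n N (X : 'M[bool]_(N, d)) (l : 'I_N) j :
  (2 <= d)%N -> (N + N <= n)%N ->
  `|attn_at (hard_stream R n X) (N + l) ord0 j - (X l j)%:R| <= n%:R^-1.
Proof.
move=> d2 Nn; set x := hard_stream R n X.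
have lN : (l < (N + l).+1)%N by lia.
have n0 : 0 < n%:R :> R by rewrite ltr0n; have := ltn_ord l; lia.
have Vl : vals x (N + l) (Ordinal lN) j = (X l j)%:R.
  rewrite !mxE /=; congr (nat_of_bool _)%:R.
  apply/existsP/idP => [[k /andP[/eqP/val_inj -> //]]|Xlj].
  by exists l; rewrite eqxx.
rewrite -Vl; apply: le_trans.
  apply: (@Attn_near _ _ _ _ _ _ _ (n%:R ^+ 2)) => [p pl|p k]; last first.
    by rewrite !mxE ler0n lern1 leq_b1.
  rewrite !hard_score// addKn /= subrr expr0n subr0.
  rewrite -lerBrDl -mulrBr ler_peMr ?sqr_ge0//.
  rewrite opprB addrC subrK -[leLHS](expr1n _ 2).
  (* What remains is 1 <= (l - p)^2 for distinct naturals, by the sign of l - p. *)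
  have [pl'|lp|pl'] := ltngtP p l; last by rewrite -val_eqE/= pl' eqxx in pl.
    rewrite ler_pXn2r// ?nnegrE//; last first.
      by rewrite subr_ge0 ler_nat ltnW.
    by rewrite lerBrDl natr1 ler_nat.
  rewrite -[leRHS]sqrrN opprB ler_pXn2r// ?nnegrE//; last first.
    by rewrite subr_ge0 ler_nat ltnW.
  by rewrite lerBrDl natr1 ler_nat.
(* There are N + l + 1 <= n keys, and n * n <= exp(n^2). *)
rewrite expRN -ler_pdivlMr ?invr_gt0 ?expR_gt0// invrK.
apply: (@le_trans _ _ n%:R).
  by rewrite ler_nat; have := ltn_ord l; lia.
rewrite mulrC ler_pdivlMr// -expr2.
by apply: le_trans (expR_ge1Dx _); rewrite lerDr.
Qed.

Lemma decodable_count disp (T : measurableType disp) (R : realType) (eta : R)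
    d n s (A : streaming_alg T R d s) w :
  0 < eta < 1 -> (2 <= d)%N -> n%:R^-1 <= (1 - eta) / 4 ->
  (#|[set X : 'M[bool]_(n./2, d) | `[< forall i, (i < n)%N ->
      Defs.approx eta (answer A w (hard_stream R n X) i)
        (attn_at (hard_stream R n X) i) >]]%SET| <= 2 ^ s)%N.
Proof.
move=> eta01 d2 neta; set N := n./2; set S := finset _.
have NNn : (N + N <= n)%N by rewrite /N; lia.
rewrite -card_bool -card_tuple.
rewrite -(@card_in_imset _ _ (fun X => memory A w (hard_stream R n X) N)).
  exact: max_card.
move=> X Y; rewrite !inE => /asboolP SX /asboolP SY memXY.
apply/matrixP => l j.
have iN : (N + l < n)%N by have := ltn_ord l; lia.
(* From time [N] on the values are zero, so the matrix no longer enters the stream. *)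
have agree i : (N <= i)%N -> hard_stream R n X i = hard_stream R n Y i.
  move=> Ni; congr Triple; apply/rowP => k; rewrite !mxE.
  congr (nat_of_bool _)%:R.
  by apply/existsP/existsP => -[m /andP[/eqP mi]]; have := ltn_ord m; lia.
(* A single answer at step [N + l] thus approximates both attentions, which forces equal bits. *)
have eqans := answer_determined memXY agree (leq_addr l N).
apply: (approx_bit_inj eta01 neta (hard_attn R X l j d2 NNn)
  (hard_attn R Y l j d2 NNn)); last exact: (SY _ iN j).
by rewrite -eqans; exact: (SX _ iN j).
Qed.

Theorem theorem1 (R : realType) (eta : R) (heta : 0 < eta < 1) :
  exists (c : R) (a n0 : nat), 0 < c /\
    forall d n : nat, (2 <= d)%N -> (n0 <= n)%N ->
    forall D : set (triple R d), bounded_int_triples R d (n ^ a) `<=` D ->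
    forall (disp : measure_display) (T : measurableType disp)
      (P : probability T R) (s : nat) (A : streaming_alg T R d s),
      approximates_attention P A D n eta ->
      c * (d%:R * Num.min n%:R (expR d%:R)) <= s%:R.
Proof.
have eta0 : 0 < (1 - eta) / 4 by lra.
(* [n0] ensures 1/n <= (1 - eta) / 4, the precision needed to decode bits, and n >= 2, whence n <= 4
   (n/2) with the rounded half; this gives the constant 1/4. *)
exists (1 / 4), 3%N, (Num.bound ((1 - eta) / 4)^-1 + 2)%N.
split=> [|d n d2 n0 D subD disp T P s A Aok]; first by lra.
have neta : n%:R^-1 <= (1 - eta) / 4.
  rewrite -[leRHS]invrK lef_pV2 ?posrE ?invr_gt0 ?ltr0n; [|lia|by []].
  apply/ltW; apply: lt_le_trans (archi_boundP _) _.
    by rewrite invr_ge0 ltW.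
  by rewrite ler_nat; lia.
set N := n./2.
have count : 9 / 10 * #|{: 'M[bool]_(N, d)}|%:R <= (2 ^ s)%:R :> R.
  apply: (expected_count (P := P)) => [X|X|w].
  - exact: (measurable_success A (hard_stream R n X) n eta).
  - by apply: Aok => i ltin; apply: subD; exact: hard_stream_bounded.
  - exact: decodable_count.
rewrite card_mx card_bool in count.
have Nds : (N * d <= s)%N.
  (* One missing bit would already halve the number of memory states, and 1/2 < 9/10. *)
  rewrite leqNgt; apply/negP => sNd.
  have : (2 ^ s * 2 <= 2 ^ (N * d))%N by rewrite -expnSr leq_exp2l.
  rewrite -(ler_nat R) natrM.
  have : 0 < (2 ^ s)%:R :> R by rewrite ltr0n expn_gt0.
  lra.
have : (n * d <= 4 * s)%N.
  apply: (@leq_trans (4 * (N * d))%N); last by rewrite leq_mul2l.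
  by rewrite mulnA leq_mul2r; apply/orP; right; rewrite /N; lia.
rewrite -(ler_nat R) !natrM => nds.
apply: (@le_trans _ _ (1 / 4 * (d%:R * n%:R))); last by lra.
by rewrite ler_wpM2l ?ler_wpM2l ?ler0n// ?ge_min ?lexx//; lra.
Qed.
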